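(* Let $\mathbb{U}$ be a universe set. If $\mathcal{F}$ is a finite SVN-filter base on $\mathcal{SVN}(\mathbb{U})$, then the neutrosophic filter completion $\langle \mathcal{F} \rangle$ is an SVN-principal filter over $\mathbb{U}$.
   Context: A single valued neutrosophic set (SVN-set) over a set $\mathbb{U}$ is a triple $\widetilde{A} = \langle \mu_A, \sigma_A, \omega_A \rangle$ of arbitrary functions $\mathbb{U} \to [0,1]$ (membership, indeterminacy, nonmembership). $\mathcal{SVN}(\mathbb{U})$ is the set of all SVN-sets over $\mathbb{U}$. Inclusion: $\widetilde{A} \sqsubseteq \widetilde{B}$ means $\mu_A(u) \le \mu_B(u)$, $\sigma_A(u) \le \sigma_B(u)$ and $\omega_A(u) \ge \omega_B(u)$ for every $u \in \mathbb{U}$. Two SVN-sets are equal if each is included in the other. Intersection: $\widetilde{A} \sqcap \widetilde{B} = \langle \min(\mu_A,\mu_B), \min(\sigma_A,\sigma_B), \max(\omega_A,\omega_B)\rangle$ (pointwise). The neutrosophic empty set is $\widetilde{\emptyset} = \langle 0,0,1\rangle$ (constant functions). A nonempty family $\mathcal{F} \subseteq \mathcal{SVN}(\mathbb{U})$ is an SVN-filter base on $\mathcal{SVN}(\mathbb{U})$ if $\widetilde{\emptyset} \notin \mathcal{F}$ and for every $\widetilde{F}, \widetilde{G} \in \mathcal{F}$ there exists $\widetilde{H} \in \mathcal{F}$ with $\widetilde{H} \sqsubseteq \widetilde{F} \sqcap \widetilde{G}$. For an SVN-filter base $\mathcal{F}$, its neutrosophic filter completion is $\langle \mathcal{F} \rangle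 = \{ \widetilde{A} \in \mathcal{SVN}(\mathbb{U}) : \exists\, \widetilde{F} \in \mathcal{F},\ \widetilde{F} \sqsubseteq \widetilde{A} \}$. For an SVN-set $\widetilde{A} \ne \widetilde{\emptyset}$ over $\mathbb{U}$, the SVN-principal filter generated by $\widetilde{A}$ is the family $\{ \widetilde{B} \in \mathcal{SVN}(\mathbb{U}) : \widetilde{A} \sqsubseteq \widetilde{B} \}$ of all neutrosophic supersets of $\widetilde{A}$. An SVN-principal filter over $\mathbb{U}$ is a family of this form for some $\widetilde{A} \ne \widetilde{\emptyset}$. *)

(* Defs.v *)
From mathcomp Require Import all_boot all_order all_algebra.
From mathcomp Require Import boolp classical_sets cardinality reals
  interval_inference.

Set Implicit Arguments.
Unset Strict Implicit.
Unset Printing Implicit Defensive.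

Import Order.TTheory GRing.Theory Num.Theory.
Local Open Scope classical_set_scope.
Local Open Scope ring_scope.

(* Single valued neutrosophic sets over U; [{i01 R}] is the library's unit
   interval [0, 1], with the order inherited from R. *)
Record svn (R : realType) (U : Type) := SVN {
  mu    : U -> {i01 R};
  sigma : U -> {i01 R};
  omega : U -> {i01 R} }.

Section SVN.
Context {R : realType} {U : Type}.
Implicit Types (A B F G H : svn R U) (FF : set (svn R U)).

Definition svn_sub A B : Prop :=
  forall u : U, [/\ mu A u <= mu B u, sigma A u <= sigma B u
                  & omega B u <= omega A u].

Definition svn_inter A B : svn R U :=
  SVN (fun u => Order.min (mu A u) (mu B u))
      (fun u => Order.min (sigma A u) (sigma B u))
      (fun u => Order.max (omega A u) (omega B u)).

Definition svn_empty : svn R U :=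
  SVN (fun=> 0%:i01) (fun=> 0%:i01) (fun=> 1%:i01).

(* Equality of SVN-sets, meant as mutual inclusion, is Leibniz equality. *)
Lemma svn_eqP A B : A = B <-> svn_sub A B /\ svn_sub B A.
Proof.
split=> [->|]; first by split=> u; split.
case: A B => [m s o] [m' s' o'] [/= AB BA].
by congr SVN; apply/funext => u; apply/le_anti/andP;
  case: (AB u) (BA u) => /= ? ? ? [].
Qed.

Definition svn_filter_base FF : Prop :=
  [/\ FF !=set0, ~ FF svn_empty &
      forall F G, FF F -> FF G ->
        exists2 H, FF H & svn_sub H (svn_inter F G)].

Definition svn_completion FF : set (svn R U) :=
  [set A | exists2 F, FF F & svn_sub F A].

Definition svn_principal A : set (svn R U) := [set B | svn_sub A B].

Definition is_svn_principal_filter FF : Prop :=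
  exists A, A <> svn_empty /\ FF = svn_principal A.

End SVN.

(* Main.v *)
(** Directedness makes any finitely many members of the base have a common
    lower bound in the base, so a finite base has a least member; its
    completion is the principal filter generated by that member. *)

Require Import Defs.
From mathcomp Require Import all_boot all_order all_algebra.
From mathcomp Require Import boolp classical_sets cardinality reals.
From mathcomp Require Import interval_inference.

Import Order.TTheory.
Local Open Scope classical_set_scope.

Section SvnOrder.
Context {R : realType} {U : Type}.
Implicit Types (A B F G H : svn R U) (FF : set (svn R U)).

Lemma svn_sub_refl A : svn_sub A A.
Proof. by move=> u; split. Qed.

Lemma svn_sub_trans B A F : svn_sub A B -> svn_sub B F -> svn_sub A F.
Proof.
move=> AB BF u; have [m1 s1 o1] := AB u; have [m2 s2 o2] := BF u.
by split; [apply: le_trans m2|apply: le_trans s2|apply: le_trans o1].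
Qed.

Lemma svn_sub_interl A B : svn_sub (svn_inter A B) A.
Proof. by move=> u; split=> /=; rewrite ?ge_min ?le_max lexx. Qed.

Lemma svn_sub_interr A B : svn_sub (svn_inter A B) B.
Proof. by move=> u; split=> /=; rewrite ?ge_min ?le_max lexx orbT. Qed.

End SvnOrder.

(** Induction on a list enumerating [A]: directedness, applied to the bound found so far and the
    next element, yields a new bound that is again in [A] and below both. *)
Lemma finite_directed_least (T : Type) (le : T -> T -> Prop) (A : set T) :
  (forall x, le x x) -> (forall y x z, le x y -> le y z -> le x z) ->
  finite_set A -> A !=set0 ->
  (forall x y, A x -> A y -> exists2 z, A z & le z x /\ le z y) ->
  exists2 m, A m & forall x, A x -> le m x.
Proof.
move=> le_re le_tr finA [a Aa] dirA.
have [s As] : exists s : seq {classic T}, A = [set` s] by exact/finite_seqP.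
(* The equation [As] would not survive induction on [s]; bounding only those entries of [s] that lie
   in [A] keeps [A] fixed. *)
suff [m Am mle] : exists2 m, A m &
    forall x : {classic T}, x \in s -> A x -> le m x.
  by exists m => // x Ax; apply: mle => //; move: Ax; rewrite {1}As.
elim: s {As} => [|b s [m Am mle]]; first by exists a.
(* An entry [b] outside [A] imposes no condition, so the old bound [m] is kept. *)
have [Ab|nAb] := pselect (A b); last first.
  by exists m => // x; rewrite inE => /orP[/eqP->//|]; exact: mle.
have [z Az [zb zm]] := dirA _ _ Ab Am.
exists z => // x; rewrite inE => /orP[/eqP->//|xs Ax].
exact: le_tr zm (mle _ xs Ax).
Qed.

Theorem proposition3p19 (R : realType) (U : Type) (FF : set (svn R U)) :
  finite_set FF -> svn_filter_base FF ->
  is_svn_principal_filter (svn_completion FF).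
Proof.
move=> finFF [FF0 FFe FFI].
have [||F G FF_F FF_G|M FF_M minM] :=
    finite_directed_least _ (@svn_sub R U) _ _ _ finFF FF0.
- exact: svn_sub_refl.
- exact: svn_sub_trans.
(* The intersection lies below [F] and [G], hence so does [H]. *)
- have [H FF_H HI] := FFI _ _ FF_F FF_G.
  by exists H => //; split; apply: svn_sub_trans HI _;
    [exact: svn_sub_interl|exact: svn_sub_interr].
exists M; split=> [Me|]; first by apply: FFe; rewrite -Me.
(* A superset of [M] is in the completion with [M] itself as witness; conversely, [M] lies below any
   witness [F]. *)
apply/seteqP; split=> B /=; last by move=> MB; exists M.
by move=> [F /minM MF FB]; exact: svn_sub_trans MF FB.
Qed.
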